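(* Let $\alpha=[a_1,a_2,\dots]\in(0,1)$ be irrational with unbounded partial quotients $(a_k)$, and set $$\ell_e=\liminf_{k\to\infty}\frac{\sum_{1\le m\le k,\ m\text{ even}}a_m}{\sum_{m=1}^k a_m},\qquad \ell_o=\liminf_{k\to\infty}\frac{\sum_{1\le m\le k,\ m\text{ odd}}a_m}{\sum_{m=1}^k a_m}.$$ If $\ell_e^2+\ell_o^2>0$ and $$\limsup_{k\to\infty}\frac{k}{\sum_{m=1}^k a_m}=0,$$ then $$\frac14\max\{\ell_e,\ell_o\}\le\limsup_{n\to\infty}\frac{nD_n^*(\alpha)}{\sum_{m=1}^{\mathrm{ord}(n-1)+1}a_m}\le\frac14.$$
   Context: $[a_1,a_2,\dots]=1/(a_1+1/(a_2+\cdots))$ with positive integers $a_h$ (the partial quotients); $q_n$ is the denominator of the convergent $[a_1,\dots,a_n]$: $q_0=1$, $q_1=a_1$, $q_{n+1}=a_{n+1}q_n+q_{n-1}$. The discrepancy of $(n\alpha)$ is $D_n^*(\alpha):=\sup_{\beta\in(0,1)}\big|\tfrac1n d_n(\alpha,\beta)\big|$, where $d_n(\alpha,\beta):=\sum_{r=0}^{n-1}\chi_{[0,\beta)}(\{r\alpha\})-\beta n$ and $\{\cdot\}$ is the fractional part. Order of an integer: every positive integer $r$ can be written uniquely as $r=\sum_{h=0}^N c_hq_h$ (Ostrowski representation) with integers $0\le c_0\le a_1-1$, $0\le c_h\le a_{h+1}$ for $h\ge1$, $c_{h-1}=0$ whenever $c_h=a_{h+1}$ ($h\ge1$), and $c_N>0$;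 then $\mathrm{ord}(r):=N$. *)

(* Defs.v *)
From mathcomp Require Import all_boot all_order all_algebra.
From mathcomp Require Import all_classical all_reals all_analysis.

Set Implicit Arguments.
Unset Strict Implicit.
Unset Printing Implicit Defensive.

Import Order.TTheory GRing.Theory Num.Theory.
Import numFieldNormedType.Exports.

Local Open Scope classical_set_scope.
Local Open Scope ring_scope.

(* Partial quotients are a 1, a 2, ...: the value a 0 is never used. *)

(* [a_1, ..., a_k] = 1 / (a_1 + 1 / (a_2 + ...)), and 0 for the empty list *)
Fixpoint fin_cfrac (R : realType) (s : seq nat) : R :=
  if s is b :: s' then (b%:R + fin_cfrac R s')^-1 else 0.

Definition cfrac_expansion (R : realType) (a : nat -> nat) (alpha : R) : Prop :=
  (forall h, (1 <= h)%N -> (0 < a h)%N) /\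
  (fin_cfrac R [seq a h | h <- iota 1 k] @[k --> \oo] --> alpha).

Fixpoint cf_denom (a : nat -> nat) (n : nat) : nat :=
  match n with
  | 0 => 1%N
  | m.+1 => if m is l.+1 then (a m.+1 * cf_denom a m + cf_denom a l)%N else a 1%N
  end.

(* Only c 0, ..., c N matter. *)
Definition ostrowski (a : nat -> nat) (r N : nat) (c : nat -> nat) : Prop :=
  [/\ r = (\sum_(0 <= h < N.+1) c h * cf_denom a h)%N,
      (c 0%N <= a 1%N - 1)%N,
      forall h, (1 <= h <= N)%N -> (c h <= a h.+1)%N,
      forall h, (1 <= h <= N)%N -> c h = a h.+1 -> c h.-1 = 0%N
    & (0 < c N)%N].

(* The default value 0 is taken only when r has no representation (r = 0). *)
Definition ostrowski_ord (a : nat -> nat) (r : nat) : nat :=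
  xget 0%N [set N | exists c, ostrowski a r N c].

Definition frac_part (R : realType) (x : R) : R := x - (Num.floor x)%:~R.

Definition local_discr (R : realType) (n : nat) (alpha beta : R) : R :=
  \sum_(0 <= r < n) \1_[set x | 0 <= x < beta] (frac_part (r%:R * alpha))
  - beta * n%:R.

Definition star_discrepancy (R : realType) (n : nat) (alpha : R) : R :=
  sup [set `|n%:R^-1 * local_discr n alpha beta| | beta in [set b | 0 < b < 1]].

Definition pq_sum (a : nat -> nat) (k : nat) : nat := (\sum_(1 <= m < k.+1) a m)%N.

Definition ell_even (R : realType) (a : nat -> nat) : \bar R :=
  limn_einf (fun k : nat =>
    ((\sum_(1 <= m < k.+1 | ~~ odd m) a m)%N%:R / (pq_sum a k)%:R)%:E).

Definition ell_odd (R : realType) (a : nat -> nat) : \bar R :=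
  limn_einf (fun k : nat =>
    ((\sum_(1 <= m < k.+1 | odd m) a m)%N%:R / (pq_sum a k)%:R)%:E).

(* Main.v *)
Require Import Defs.
From mathcomp Require Import all_boot all_order all_algebra.
From mathcomp Require Import all_classical all_reals all_analysis.
From mathcomp Require Import ring lra zify.

Import Order.TTheory GRing.Theory Num.Theory.
Import numFieldNormedType.Exports.

Local Open Scope classical_set_scope.
Local Open Scope ring_scope.

(** Let [{x}] be the fractional part, and let [S n z] be the sum of the values
    [{z + j * alpha} - 1/2] for [j < n].  The indicator of [[0, beta)] at [{x}]
    equals [beta + {x - beta} - {x}], so the local discrepancy at [beta] is
    [S n (- beta) - S n 0].  Everything thus reduces to the sums [S].

    Write [n] as a sum of [b_h * q_h] and cut the orbit into blocks of [q_h]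
    points.  A block is a slightly drifting copy of the lattice of multiples of
    [1 / q_h], over which the sawtooth sums to a single sawtooth value at the
    [q_h]-fold point ([sum_sawtooth_lattice]).  Hence, up to a bounded error,
    the [b_h] blocks of level [h] contribute the sawtooth sum of [b_h] points in
    progression with step [eta_h = q_h * |q_h * alpha - p_h|]
    ([sawtooth_sum_blocks]), and [1 / eta_h] is [a_(h+1)] up to a bounded error.

    Upper bound.  These points go around the circle at most once, so their
    contribution is at most [b_h * (1 - b_h * eta_h) / 2]
    ([sawtooth_sum_short_arc]), which never exceeds [a_(h+1) / 8] by more than a
    constant.  As two sums [S] occur, the discrepancy is at most a quarter of
    the sum of the partial quotients, plus a multiple of the number of levels
    ([star_discrepancy_upper]).  The levels are negligible because the partial
    quotients have infinite mean.

    Lower bound.  For [beta = {n * alpha}] the sum [S n (- beta)] runs through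
    the reflected orbit, and the local discrepancy is [- 2 * S n 0] up to a
    bounded error ([local_discr_orbit]).  Let the digits of [n] be half of the
    maximal ones at the places of one parity and [0] elsewhere.  Then at every
    level the progression starts next to an integer, always on the same side,
    and covers half of the circle, so all the contributions have the same sign
    and size about [a_(h+1) / 8] ([half_digit_sawtooth_sum]).  This gives a
    quarter of the sum of the partial quotients of the chosen parity
    ([star_discrepancy_lower]), to be compared with the sum of all of them. *)

(** * Fractional parts *)

Lemma frac_part_ge0 {R : realType} (x : R) : 0 <= frac_part x.
Proof. by rewrite subr_ge0 floor_le. Qed.

Lemma frac_part_lt1 {R : realType} (x : R) : frac_part x < 1.
Proof. by rewrite ltrBlDl -[1]/(1%:~R) -intrD floorD1_gt. Qed.

Lemma frac_part_unique {R : realType} (x t : R) (m : int) :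
  x = m%:~R + t -> 0 <= t < 1 -> frac_part x = t.
Proof.
move=> xE /andP[t0 t1]; rewrite /frac_part (@floor_def _ x m) ?xE; first by ring.
by rewrite lerDl t0 intrD ltrD2l.
Qed.

Lemma frac_partDz {R : realType} (x : R) (m : int) :
  frac_part (x + m%:~R) = frac_part x.
Proof.
apply: (@frac_part_unique _ _ _ (Num.floor x + m)).
  by rewrite intrD /frac_part; ring.
by rewrite frac_part_ge0 frac_part_lt1.
Qed.

Lemma frac_partD_le {R : realType} (x e : R) :
  0 <= e -> frac_part (x + e) <= frac_part x + e.
Proof.
move=> e0; rewrite /frac_part.
have : (Num.floor x)%:~R <= (Num.floor (x + e))%:~R :> R.
  by rewrite ler_int le_floor// lerDl.
by lra.
Qed.

Lemma frac_part_le {R : realType} (x : R) : 0 <= x -> frac_part x <= x.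
Proof. by rewrite -floor_ge0 lerBlDr lerDl ler0z. Qed.

Lemma frac_part_neg_ge {R : realType} (x : R) : x < 0 -> 1 + x <= frac_part x.
Proof.
rewrite -floor_lt0 => x0; rewrite /frac_part.
have : (Num.floor x)%:~R <= (-1)%:~R :> R by rewrite ler_int; lia.
by rewrite intrN; lra.
Qed.

Lemma frac_partN {R : realType} (x : R) :
  0 < frac_part x -> frac_part (- x) = 1 - frac_part x.
Proof.
move=> x0; apply: (@frac_part_unique _ _ _ (- Num.floor x - 1)).
  by rewrite intrD !intrN /frac_part; ring.
by have := frac_part_lt1 x; lra.
Qed.

Lemma frac_part_irrational_gt0 {R : realType} (alpha : R) (n : nat) :
  irrational alpha -> (0 < n)%N -> 0 < frac_part (n%:R * alpha).
Proof.
move=> irr n0; rewrite lt_neqAle frac_part_ge0 andbT eq_sym subr_eq0.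
apply/negP => /eqP nE; apply: irr.
have nR0 : n%:R != 0 :> R by rewrite pnatr_eq0 -lt0n.
apply/rationalP; exists (Num.floor (n%:R * alpha)), n.
by rewrite -nE mulrC mulKf.
Qed.

(** The indicator of an interval is an affine function of two fractional
    parts, which turns every question on [local_discr] into one on sums of
    sawtooth values. *)
Lemma indic_frac_part {R : realType} (x beta : R) : 0 < beta < 1 ->
  \1_[set y : R | 0 <= y < beta] (frac_part x) - beta
    = frac_part (x - beta) - frac_part x.
Proof.
move=> /andP[b0 b1]; rewrite indicE.
have [x0 x1] := (frac_part_ge0 x, frac_part_lt1 x).
have [xb|xb] := ltP (frac_part x) beta.
  rewrite mem_set /=; last by rewrite x0 xb.
  rewrite (@frac_part_unique _ (x - beta) (frac_part x + 1 - beta)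
    (Num.floor x - 1)); [by ring| |lra].
  by rewrite intrD intrN /frac_part; ring.
rewrite memNset /=; last by rewrite x0 ltNge xb.
rewrite (@frac_part_unique _ (x - beta) (frac_part x - beta)
  (Num.floor x)); [by ring| |lra].
by rewrite /frac_part; ring.
Qed.

Lemma sum_natr {R : realType} (n : nat) :
  \sum_(0 <= i < n) i%:R = n%:R * (n%:R - 1) / 2 :> R.
Proof.
elim: n => [|n IH]; first by rewrite big_geq//; ring.
by rewrite big_nat_recr //= IH -(natr1 n); field.
Qed.

(** * The sawtooth sum over a full period *)

(** An affine map whose slope is a unit permutes the residues. *)
Lemma sum_modz_affine {R : realType} (p q : nat) (m : int) :
  (0 < q)%N -> coprime p q ->
  \sum_(0 <= r < q) ((m + (r * p)%N%:Z) %% q%:Z)%Z%:~R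
    = q%:R * (q%:R - 1) / 2 :> R.
Proof.
case: q => // q _ cop; rewrite -sum_natr !big_mkord.
pose s (i : 'I_q.+1) : 'I_q.+1 :=
  inord `|((m + (i * p)%N%:Z) %% q.+1%:Z)%Z|%N.
have sE i : (s i : nat)%:Z = ((m + (i * p)%N%:Z) %% q.+1%:Z)%Z.
  have h0 : (0 <= (m + (i * p)%N%:Z) %% q.+1%:Z)%Z by rewrite modz_ge0.
  have h1 : ((m + (i * p)%N%:Z) %% q.+1%:Z < q.+1%:Z)%Z by rewrite ltz_pmod.
  by rewrite inordK; [rewrite gez0_abs|lia].
have s_inj : injective s.
  move=> i j /(congr1 (fun k : 'I_q.+1 => (k : nat)%:Z)).
  rewrite !sE => /eqP; rewrite eqz_mod_dvd.
  rewrite (_ : _ - _ = (i%:Z - j%:Z) * p%:Z); last by rewrite !PoszM; ring.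
  rewrite Gauss_dvdzl; last by rewrite coprimezE /= coprime_sym.
  rewrite -eqz_mod_dvd !modz_small ?ltz_nat ?ltn_ord// => /eqP[ij].
  exact: val_inj.
rewrite [RHS](reindex_inj s_inj) /=; apply: eq_bigr => i _.
by rewrite -sE.
Qed.

(** Write [q * w = m + t] with [m] the integer part: the [r]-th term has
    fractional part [((m + r * p) %% q + t) / q], and the residues run through
    all of [0, ..., q - 1]. *)
Lemma sum_sawtooth_lattice {R : realType} (p q : nat) (w : R) :
  (0 < q)%N -> coprime p q ->
  \sum_(0 <= r < q) (frac_part (w + r%:R * p%:R / q%:R) - 1 / 2)
    = frac_part (q%:R * w) - 1 / 2.
Proof.
move=> q0 cop; set t := frac_part (q%:R * w).
have qR : 0 < q%:R :> R by rewrite ltr0n.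
pose m := Num.floor (q%:R * w).
have wE : w = (m%:~R + t) / q%:R.
  by rewrite /t /frac_part -/m; field; rewrite gt_eqF.
rewrite (eq_bigr (fun r : nat =>
  (((m + (r * p)%N%:Z) %% q%:Z)%Z%:~R : R) / q%:R + (t / q%:R - 1 / 2))).
  rewrite big_split /= -mulr_suml sum_modz_affine// sumr_const_nat subn0.
  by rewrite -mulr_natl; field; rewrite gt_eqF.
move=> r _; rewrite addrA; congr (_ - _).
apply: (@frac_part_unique _ _ _ ((m + (r * p)%N%:Z) %/ q%:Z)%Z).
  have := divz_eq (m + (r * p)%N%:Z) q%:Z.
  move=> /(congr1 (fun z : int => z%:~R : R)).
  rewrite !intrD !intrM -!pmulrn natrM => e.
  rewrite {1}wE.
  have -> : (m%:~R + t) / q%:R + r%:R * p%:R / q%:R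
     = (m%:~R + r%:R * p%:R + t) / q%:R :> R by field; rewrite gt_eqF.
  by rewrite e; field; rewrite gt_eqF.
rewrite -mulrDl ler_pdivlMr// ltr_pdivrMr// mul0r mul1r.
have h0 : 0 <= ((m + (r * p)%N%:Z) %% q%:Z)%Z%:~R :> R.
  by rewrite ler0z modz_ge0//; lia.
have h1 : ((m + (r * p)%N%:Z) %% q%:Z)%Z%:~R + 1 <= q%:R :> R.
  have : ((m + (r * p)%N%:Z) %% q%:Z < q%:Z)%Z by rewrite ltz_pmod//; lia.
  rewrite -lezD1 -(ler_int R) intrD; exact: le_trans.
have := frac_part_ge0 (q%:R * w); have := frac_part_lt1 (q%:R * w).
by rewrite -/t; lra.
Qed.

(** * Sawtooth sums along a rotation *)

Definition sawtooth_sum {R : realType} (alpha z : R) (n : nat) : R :=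
  \sum_(0 <= j < n) (frac_part (z + j%:R * alpha) - 1 / 2).

Lemma sawtooth_sumD {R : realType} (alpha z : R) (m n : nat) :
  sawtooth_sum alpha z (m + n)
    = sawtooth_sum alpha z m + sawtooth_sum alpha (z + m%:R * alpha) n.
Proof.
rewrite /sawtooth_sum (@big_cat_nat _ _ _ m) ?leq_addr //=.
congr (_ + _); rewrite -{1}[m]add0n big_addn addKn; apply: eq_bigr => j _.
by rewrite natrD; congr (frac_part _ - _); ring.
Qed.

Lemma sawtooth_sumDz {R : realType} (alpha z : R) (m : int) (n : nat) :
  sawtooth_sum alpha (z + m%:~R) n = sawtooth_sum alpha z n.
Proof.
apply: eq_bigr => j _; rewrite -(@frac_partDz _ (z + j%:R * alpha) m).
by congr (frac_part _ - _); ring.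
Qed.

Lemma sawtooth_sum_le_half {R : realType} (alpha z : R) (n : nat) :
  `|sawtooth_sum alpha z n| <= n%:R / 2.
Proof.
elim: n => [|n IH]; first by rewrite /sawtooth_sum big_geq// normr0 mul0r.
rewrite -addn1 sawtooth_sumD (le_trans (ler_normD _ _))// natrD mulrDl lerD//.
rewrite /sawtooth_sum big_nat1 ler_norml.
have := frac_part_ge0 (z + n%:R * alpha + 0%:R * alpha).
have := frac_part_lt1 (z + n%:R * alpha + 0%:R * alpha).
by lra.
Qed.

(** Over [q] steps the rotation deviates from the lattice [p / q] by a drift
    between [u] and [v].  Since the sawtooth jumps only downwards, moving a
    point forwards raises its value by at most the displacement; comparing
    with the lattices shifted by [u] and by [v] thus bounds the sum from both
    sides, however many points jump. *)
Lemma sawtooth_sum_block {R : realType} (alpha theta u v w : R) (p q : nat) :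
  (0 < q)%N -> coprime p q -> q%:R * alpha = p%:R + theta ->
  u <= 0 <= v -> u <= theta <= v ->
  frac_part (q%:R * (w + v)) - 1 / 2 - q%:R * (v - u)
    <= sawtooth_sum alpha w q
    <= frac_part (q%:R * (w + u)) - 1 / 2 + q%:R * (v - u).
Proof.
move=> q0 cop aE /andP[u0 v0] /andP[ut tv].
have qR : 0 < q%:R :> R by rewrite ltr0n.
have alphaE : alpha = p%:R / q%:R + theta / q%:R.
  by rewrite -mulrDl -aE mulrC mulKf// gt_eqF.
have drift (r : nat) : (r < q)%N -> u <= r%:R * theta / q%:R <= v.
  move=> rq; have rq1 : r%:R / q%:R <= 1 :> R.
    by rewrite ler_pdivrMr// mul1r ler_nat ltnW.
  have rq0 : 0 <= r%:R / q%:R :> R by rewrite divr_ge0.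
  by rewrite mulrAC; nra.
rewrite -!(sum_sawtooth_lattice _ _ _ q0 cop) /sawtooth_sum.
have cst : q%:R * (v - u) = \sum_(0 <= r < q) (v - u).
  by rewrite sumr_const_nat subn0 mulr_natl.
rewrite cst -sumrB -big_split /=; apply/andP; split.
  apply: ler_sum_nat => r /andP[_ rq].
  have /andP[d0 d1] := drift r rq.
  have -> : w + v + r%:R * p%:R / q%:R
      = w + r%:R * alpha + (v - r%:R * theta / q%:R).
    by rewrite alphaE; ring.
  have := @frac_partD_le _ (w + r%:R * alpha) (v - r%:R * theta / q%:R).
  by rewrite subr_ge0 => /(_ d1); lra.
apply: ler_sum_nat => r /andP[_ rq].
have /andP[d0 d1] := drift r rq.
have -> : w + r%:R * alpha
    = w + u + r%:R * p%:R / q%:R + (r%:R * theta / q%:R - u).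
  by rewrite alphaE; ring.
have := @frac_partD_le _ (w + u + r%:R * p%:R / q%:R)
  (r%:R * theta / q%:R - u).
by rewrite subr_ge0 => /(_ d0); lra.
Qed.

(** The one-sided errors of consecutive blocks telescope, because the end of
    the drift of a block is the beginning of the drift of the next one. *)
Lemma sawtooth_sum_blocks {R : realType} (alpha theta z : R) (p q b : nat) :
  (0 < q)%N -> coprime p q -> q%:R * alpha = p%:R + theta ->
  `|sawtooth_sum alpha z (b * q)
    - sawtooth_sum (q%:R * theta) (q%:R * z) b|
    <= b%:R * (q%:R * `|theta|) + 1.
Proof.
move=> q0 cop aE; pose phi i := frac_part (q%:R * z + i%:R * (q%:R * theta)).
have phiE i (e : nat) : frac_part (q%:R * (z + (i * q)%:R * alpha + e%:R * theta))
    = phi (i + e)%N.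
  rewrite /phi -[RHS](@frac_partDz _ _ (q * i * p)%N%:Z); congr frac_part.
  rewrite -pmulrn !natrM natrD.
  transitivity (q%:R * z + q%:R * i%:R * (q%:R * alpha) + q%:R * e%:R * theta).
    by ring.
  by rewrite aE; ring.
have phiS i : sawtooth_sum (q%:R * theta) (q%:R * z) i.+1
    = sawtooth_sum (q%:R * theta) (q%:R * z) i + (phi i - 1 / 2).
  by rewrite /sawtooth_sum big_nat_recr.
have phi01 i : 0 <= phi i < 1 by rewrite frac_part_ge0 frac_part_lt1.
have S0 be x : sawtooth_sum be x 0 = 0 :> R by rewrite /sawtooth_sum big_geq.
have [t0|t0] := ger0P theta.
  suff : sawtooth_sum (q%:R * theta) (q%:R * z) b + phi b - phi 0%N
      - b%:R * (q%:R * theta) <= sawtooth_sum alpha z (b * q)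
      <= sawtooth_sum (q%:R * theta) (q%:R * z) b + b%:R * (q%:R * theta).
    by have := phi01 b; have := phi01 0%N; rewrite ler_norml; lra.
  elim: b => [|b IH]; first by rewrite mul0n !S0 mul0r; lra.
  rewrite mulSnr sawtooth_sumD phiS -(natr1 b).
  have := @sawtooth_sum_block _ alpha theta 0 theta (z + (b * q)%:R * alpha)
    p q q0 cop aE.
  have := phiE b 0%N; rewrite addn0 [0%:R * theta]mul0r => ->.
  have := phiE b 1%N; rewrite addn1 [1%:R * theta]mul1r => ->.
  rewrite lexx t0 lexx => /(_ isT isT); move: IH; lra.
suff : sawtooth_sum (q%:R * theta) (q%:R * z) b
    + b%:R * (q%:R * theta) <= sawtooth_sum alpha z (b * q)
    <= sawtooth_sum (q%:R * theta) (q%:R * z) b + phi b - phi 0%N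
    - b%:R * (q%:R * theta).
  by have := phi01 b; have := phi01 0%N; rewrite ler_norml; lra.
elim: b => [|b IH]; first by rewrite mul0n !S0 mul0r; lra.
rewrite mulSnr sawtooth_sumD phiS -(natr1 b).
have := @sawtooth_sum_block _ alpha theta theta 0 (z + (b * q)%:R * alpha)
  p q q0 cop aE.
have := phiE b 0%N; rewrite addn0 [0%:R * theta]mul0r => ->.
have := phiE b 1%N; rewrite addn1 [1%:R * theta]mul1r => ->.
by rewrite lexx (ltW t0) lexx => /(_ isT isT); move: IH; lra.
Qed.

Lemma sawtooth_sum_reverse {R : realType} (eta x : R) (b : nat) :
  sawtooth_sum eta x b = sawtooth_sum (- eta) (x + (b%:R - 1) * eta) b.
Proof.
rewrite /sawtooth_sum big_nat_rev /=; apply: eq_big_nat => i /andP[_ ib].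
congr (frac_part _ - _); rewrite add0n natrB//; rewrite -natr1; ring.
Qed.

(** The points of a progression of total length at most [1] wrap around the
    circle at most once.  If the first [m] of the [b] points, and only these,
    precede the wrap, then the sum of the fractional parts is
    [b * f + eta * b * (b - 1) / 2 - (b - m)], where [f] is the first of them.
    The condition that [m] points do not wrap bounds this from above, the
    condition that the next one does bounds it from below. *)
Lemma sawtooth_sum_short_arc_pos {R : realType} (eta x : R) (b : nat) :
  0 <= eta -> b%:R * eta <= 1 ->
  `|sawtooth_sum eta x b| <= b%:R / 2 - eta * b%:R * (b%:R - 1) / 2.
Proof.
move=> eta0 beta1; pose f := frac_part x.
have f0 : 0 <= f := frac_part_ge0 x.
have f1 : f < 1 := frac_part_lt1 x.
have [->|b0] := posnP b.
  by rewrite /sawtooth_sum big_geq// normr0 mulr0 !mul0r subr0.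
suff [m [mb SE m0 m1]] : exists m : nat, [/\ (m <= b)%N,
    sawtooth_sum eta x b
      = b%:R * f + eta * b%:R * (b%:R - 1) / 2 - (b%:R - m%:R) - b%:R / 2,
    (m < b)%N -> 1 <= f + m%:R * eta &
    (0 < m)%N -> f + (m%:R - 1) * eta < 1].
  rewrite SE ler_norml; move: mb; rewrite leq_eqVlt => /predU1P[mE|mb].
    have := m1; rewrite mE b0 => /(_ isT) {}m1.
    have := mulr_ge0 (ler0n R b) f0.
    have : b%:R * (f + (b%:R - 1) * eta) <= b%:R * 1 by rewrite ler_wpM2l// ltW.
    by rewrite mulr1; lra.
  have := m0 mb => {}m0.
  have mbR : m%:R + 1 <= b%:R :> R by rewrite natr1 ler_nat.
  have mge : 1 <= m%:R :> R.
    rewrite ler1n lt0n; apply/negP => /eqP mE.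
    by move: m0; rewrite mE mul0r addr0 leNgt f1.
  have := m1; rewrite -(ltr0n R) => /(_ ltac:(lra)) {}m1.
  have bR : 0 <= b%:R :> R by [].
  apply/andP; split.
    have : b%:R * (1 - m%:R * eta) <= b%:R * f by rewrite ler_wpM2l//; lra.
    by nra.
  have : b%:R * f <= b%:R * (1 - (m%:R - 1) * eta) by rewrite ler_wpM2l//; lra.
  have : (b%:R - m%:R) * (b%:R * eta) <= b%:R - m%:R.
    by rewrite -[leRHS]mulr1 ler_wpM2l//; lra.
  by nra.
have fr (i : nat) : frac_part (x + i%:R * eta) = frac_part (f + i%:R * eta).
  rewrite -(@frac_partDz _ (f + _) (Num.floor x)); congr frac_part.
  by rewrite /f /frac_part; ring.
clear b0; elim: b beta1 => [|b IH] beta1.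
  by exists 0%N; split => //; rewrite /sawtooth_sum big_geq//; ring.
have bE : b.+1%:R = b%:R + 1 :> R by rewrite natr1.
have b0 : 0 <= b%:R :> R by [].
have [|m [mb SE m0 m1]] := IH; first by move: beta1; rewrite bE; nra.
rewrite -addn1 sawtooth_sumD /(sawtooth_sum _ _ 1) big_nat1 mul0r addr0 fr addn1.
have [wrap|nowrap] := leP 1 (f + b%:R * eta).
  exists m; split => //; first exact: leqW.
    rewrite SE (@frac_part_unique _ _ (f + b%:R * eta - 1) 1).
    - by rewrite bE; field.
    - by rewrite -[1%:~R]/1; ring.
    - by move: beta1; rewrite bE; lra.
  move=> _; move: mb; rewrite leq_eqVlt => /predU1P[->//|/m0//].
have mE : m = b.
  apply/eqP; rewrite eqn_leq mb leqNgt; apply/negP => ltm.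
  have := m0 ltm; have : m%:R <= b%:R :> R by rewrite ler_nat.
  by nra.
exists b.+1; split => //; last by move=> _; rewrite bE; lra.
  rewrite SE mE (@frac_part_unique _ _ (f + b%:R * eta) 0).
  - by rewrite bE; field.
  - by rewrite -[0%:~R]/0; ring.
  - by rewrite nowrap andbT; nra.
by rewrite ltnn.
Qed.

Lemma sawtooth_sum_short_arc {R : realType} (eta x : R) (b : nat) :
  b%:R * `|eta| <= 1 ->
  `|sawtooth_sum eta x b| <= b%:R / 2 - `|eta| * b%:R * (b%:R - 1) / 2.
Proof.
have [e0|e0] := ger0P eta; first exact: sawtooth_sum_short_arc_pos.
rewrite sawtooth_sum_reverse; apply: sawtooth_sum_short_arc_pos.
by rewrite oppr_ge0 ltW.
Qed.

(** * Convergents and their errors *)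

(** Both sequences are shifted by one so as to include the convergent of index
    [-1], for which the recurrences hold from the start. *)
Definition conv_denom (a : nat -> nat) (n : nat) : nat :=
  if n is m.+1 then cf_denom a m else 0%N.

Fixpoint conv_num (a : nat -> nat) (n : nat) : nat :=
  match n with
  | 0 => 1%N
  | m.+1 => if m is l.+1 then (a m * conv_num a m + conv_num a l)%N else 0%N
  end.

Lemma conv_denomSS (a : nat -> nat) (n : nat) :
  conv_denom a n.+2 = (a n.+1 * conv_denom a n.+1 + conv_denom a n)%N.
Proof. by case: n => //=; rewrite muln1 addn0. Qed.

Lemma conv_numSS (a : nat -> nat) (n : nat) :
  conv_num a n.+2 = (a n.+1 * conv_num a n.+1 + conv_num a n)%N.
Proof. by []. Qed.

Lemma conv_denom_gt0 (a : nat -> nat) (n : nat) :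
  (forall h, (1 <= h)%N -> (0 < a h)%N) -> (0 < conv_denom a n.+1)%N.
Proof.
move=> a0; elim: n => // n IH.
by rewrite conv_denomSS addn_gt0 muln_gt0 a0// IH.
Qed.

Lemma conv_denom_leS (a : nat -> nat) (n : nat) :
  (forall h, (1 <= h)%N -> (0 < a h)%N) -> (conv_denom a n <= conv_denom a n.+1)%N.
Proof.
move=> a0; case: n => // n; rewrite conv_denomSS.
by rewrite (leq_trans _ (leq_addr _ _))// leq_pmull// a0.
Qed.

Lemma conv_denom_le (a : nat -> nat) (m n : nat) :
  (forall h, (1 <= h)%N -> (0 < a h)%N) -> (m <= n)%N ->
  (conv_denom a m <= conv_denom a n)%N.
Proof.
move=> a0 mn; rewrite -(subnKC mn); elim: (n - m)%N => [|d IH]; first by rewrite addn0.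
by rewrite addnS (leq_trans IH)// conv_denom_leS.
Qed.

Lemma conv_det {R : comRingType} (a : nat -> nat) (n : nat) :
  (conv_num a n.+1)%:R * (conv_denom a n)%:R
    - (conv_num a n)%:R * (conv_denom a n.+1)%:R = (-1) ^+ n.+1 :> R.
Proof.
elim: n => [|n IH]; first by rewrite /=; ring.
rewrite conv_denomSS conv_numSS !natrD !natrM exprS -IH; ring.
Qed.

Lemma conv_coprime (a : nat -> nat) (n : nat) :
  coprime (conv_num a n) (conv_denom a n).
Proof.
rewrite /coprime; set d := gcdn _ _.
have : (d%:Z %| (conv_num a n.+1)%:Z * (conv_denom a n)%:Z
    - (conv_num a n)%:Z * (conv_denom a n.+1)%:Z)%Z.
  apply: rpredB; first by rewrite dvdz_mull// dvdzE dvdn_gcdr.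
  by rewrite dvdz_mulr// dvdzE dvdn_gcdl.
have := @conv_det int a n; rewrite !natz => ->.
by rewrite dvdzE abszX exp1n dvdn1.
Qed.

Lemma fin_cfracE {R : realType} (s : seq nat) :
  fin_cfrac R s = foldr (fun b (t : R) => (b%:R + t)^-1) 0 s.
Proof. by elim: s => //= b s ->. Qed.

Lemma fin_cfrac_ge0 {R : realType} (s : seq nat) : 0 <= fin_cfrac R s.
Proof. by elim: s => //= b s IH; rewrite invr_ge0 addr_ge0. Qed.

Lemma cfrac_tail {R : realType} (a : nat -> nat) (k : nat) (t : R) :
  (forall h, (1 <= h)%N -> (0 < a h)%N) -> 0 <= t ->
  foldr (fun b (t : R) => (b%:R + t)^-1) t [seq a h | h <- iota 1 k]
    = ((conv_num a k.+1)%:R + t * (conv_num a k)%:R)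
      / ((conv_denom a k.+1)%:R + t * (conv_denom a k)%:R).
Proof.
move=> a0; elim: k t => [|k IH] t t0; first by rewrite /=; field.
have -> : iota 1 k.+1 = iota 1 k ++ [:: k.+1].
  by rewrite -{1}(addn1 k) iotaD add1n.
rewrite map_cat foldr_cat [foldr _ t _]/= IH; last first.
  by rewrite invr_ge0 addr_ge0.
have ak : 0 < (a k.+1)%:R + t by rewrite ltr_wpDr// ltr0n a0.
have q0 : 0 < (conv_denom a k.+1)%:R :> R by rewrite ltr0n conv_denom_gt0.
have ak1 : 0 < (a k.+1)%:R :> R by rewrite ltr0n a0.
rewrite conv_denomSS conv_numSS !natrD !natrM; field.
have := ler0n R (conv_denom a k); move: q0 ak ak1.
move: (conv_denom a k.+1)%:R (conv_denom a k)%:R (a k.+1)%:R => q p b q0 bt b0 p0.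
by apply/andP; split; apply: lt0r_neq0; nra.
Qed.

(** Convergents lie on alternating sides of [alpha]; the sign makes the error
    nonnegative. *)
Definition conv_err {R : realType} (a : nat -> nat) (alpha : R) (n : nat) : R :=
  (-1) ^+ n.+1 * ((conv_denom a n)%:R * alpha - (conv_num a n)%:R).

Lemma conv_errE {R : realType} (a : nat -> nat) (alpha : R) (n : nat) :
  (conv_denom a n)%:R * alpha
    = (conv_num a n)%:R + (-1) ^+ n.+1 * conv_err a alpha n.
Proof. by rewrite /conv_err signrMK; ring. Qed.

(** The value of the continued fraction lies on the same side of a convergent
    as all later convergents do: by [cfrac_tail] and [conv_det], the error of
    each of these is the product of the expected sign and a nonnegative
    number. *)
Lemma conv_err_ge0 {R : realType} {a : nat -> nat} {alpha : R} (n : nat) :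
  cfrac_expansion a alpha -> 0 <= conv_err a alpha n.
Proof.
move=> [a0 acvg]; case: n => [|n]; first by rewrite /conv_err /=; lra.
pose f (x : R) : R :=
  (-1) ^+ n.+2 * ((conv_denom a n.+1)%:R * x - (conv_num a n.+1)%:R).
have fcvg : f (fin_cfrac R [seq a h | h <- iota 1 k]) @[k --> \oo] --> f alpha.
  apply: cvgM; first exact: cvg_cst.
  apply: cvgB; last exact: cvg_cst.
  by apply: cvgM => //; exact: cvg_cst.
apply: (@cvgr_to_ge _ _ _ _ _ _ _ fcvg).
near=> k.
have -> : k = (n + (k - n))%N by rewrite subnKC//; near: k; exists n.
rewrite fin_cfracE iotaD map_cat foldr_cat -fin_cfracE.
set t := fin_cfrac R _; have t0 : 0 <= t := fin_cfrac_ge0 _.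
rewrite /f cfrac_tail//.
have den0 : 0 < (conv_denom a n.+1)%:R + t * (conv_denom a n)%:R :> R.
  by rewrite ltr_wpDr ?mulr_ge0// ltr0n conv_denom_gt0.
suff -> : (-1) ^+ n.+2 * ((conv_denom a n.+1)%:R *
    (((conv_num a n.+1)%:R + t * (conv_num a n)%:R) /
     ((conv_denom a n.+1)%:R + t * (conv_denom a n)%:R))
    - (conv_num a n.+1)%:R)
    = t / ((conv_denom a n.+1)%:R + t * (conv_denom a n)%:R) :> R.
  by rewrite divr_ge0// ltW.
transitivity ((-1) ^+ n.+1 * ((conv_num a n.+1)%:R * (conv_denom a n)%:R
    - (conv_num a n)%:R * (conv_denom a n.+1)%:R) * t
    / ((conv_denom a n.+1)%:R + t * (conv_denom a n)%:R) : R).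
  by rewrite exprS; field; rewrite gt_eqF.
by rewrite conv_det -expr2 sqrr_sign mul1r.
Unshelve. all: by end_near. Qed.

Lemma conv_err_rec {R : realType} (a : nat -> nat) (alpha : R) (n : nat) :
  conv_err a alpha n
    = (a n.+1)%:R * conv_err a alpha n.+1 + conv_err a alpha n.+2.
Proof.
rewrite /conv_err conv_denomSS conv_numSS !natrD !natrM !exprS.
by move: ((-1) ^+ n) => e; ring.
Qed.

Lemma conv_err_det {R : realType} (a : nat -> nat) (alpha : R) (n : nat) :
  (conv_denom a n.+1)%:R * conv_err a alpha n
    + (conv_denom a n)%:R * conv_err a alpha n.+1 = 1.
Proof.
transitivity ((-1) ^+ n.+1 * (-1) ^+ n.+1 : R).
  rewrite -{2}(@conv_det R a n) /conv_err !exprS.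
  by move: ((-1) ^+ n) => e; ring.
by rewrite -expr2 sqrr_sign.
Qed.

Lemma conv_err_mul_le {R : realType} {a : nat -> nat} {alpha : R} (n : nat) :
  cfrac_expansion a alpha ->
  (a n.+1)%:R * conv_err a alpha n.+1 <= conv_err a alpha n.
Proof. by move=> cf; rewrite [leRHS]conv_err_rec lerDl conv_err_ge0. Qed.

Lemma conv_err_leS {R : realType} {a : nat -> nat} {alpha : R} (n : nat) :
  cfrac_expansion a alpha -> conv_err a alpha n.+1 <= conv_err a alpha n.
Proof.
move=> cf; apply: le_trans _ (conv_err_mul_le n cf).
by rewrite ler_peMl ?conv_err_ge0// ler1n; case: cf => ->.
Qed.

Lemma conv_err_upper {R : realType} {a : nat -> nat} {alpha : R} (n : nat) :
  cfrac_expansion a alpha ->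
  (conv_denom a n.+1)%:R * conv_err a alpha n <= 1.
Proof.
by move=> cf; rewrite -[leRHS](conv_err_det a alpha n) lerDl mulr_ge0// conv_err_ge0.
Qed.

Lemma conv_err_lower {R : realType} {a : nat -> nat} {alpha : R} (n : nat) :
  cfrac_expansion a alpha ->
  1 <= ((a n.+1)%:R + 2)
    * ((conv_denom a n.+1)%:R * conv_err a alpha n.+1).
Proof.
move=> cf; rewrite -[leLHS](conv_err_det a alpha n.+1).
rewrite conv_denomSS natrD natrM.
have d0 := conv_err_ge0 n.+1 cf.
have h1 := ler_wpM2l (ler0n R (conv_denom a n.+1)) (conv_err_leS n.+1 cf).
have : (conv_denom a n)%:R <= (conv_denom a n.+1)%:R :> R.
  by rewrite ler_nat conv_denom_leS//; case: cf.
by move=> /(ler_wpM2r d0); lra.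
Qed.

(** * Upper bound for the sawtooth sums *)

Lemma pq_sumS (a : nat -> nat) (k : nat) : pq_sum a k.+1 = (pq_sum a k + a k.+1)%N.
Proof. by rewrite /pq_sum big_nat_recr. Qed.

Lemma conv_theta_norm {R : realType} {a : nat -> nat} {alpha : R} (n : nat) :
  cfrac_expansion a alpha ->
  `|(-1) ^+ n.+1 * conv_err a alpha n| = conv_err a alpha n.
Proof.
by move=> cf; rewrite normrM normrX normrN1 expr1n mul1r ger0_norm// conv_err_ge0.
Qed.

(** With [eta] the step of the reduced rotation, [b] blocks give at most
    [b * (1 - b * eta) / 2 <= 1 / (8 * eta)] up to a constant, and
    [1 / eta <= a_(k+1) + 2]. *)
Lemma sawtooth_sum_level {R : realType} (a : nat -> nat) (alpha z : R) (k b : nat) :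
  cfrac_expansion a alpha ->
  (b * conv_denom a k.+1 <= conv_denom a k.+2)%N ->
  `|sawtooth_sum alpha z (b * conv_denom a k.+1)| <= (a k.+1)%:R / 8 + 3.
Proof.
move=> cf bq; have a0 := cf.1.
have bl := sawtooth_sum_blocks alpha _ z _ _ b (conv_denom_gt0 a k a0)
  (conv_coprime a k.+1) (conv_errE a alpha k.+1).
have arc := sawtooth_sum_short_arc
  ((conv_denom a k.+1)%:R * ((-1) ^+ k.+2 * conv_err a alpha k.+1))
  ((conv_denom a k.+1)%:R * z) b.
move: bl arc; rewrite [in X in _ -> X]normrM normr_nat conv_theta_norm//.
have d0 := conv_err_ge0 k.+1 cf.
have low := conv_err_lower k cf.
have b1 : b%:R * ((conv_denom a k.+1)%:R * conv_err a alpha k.+1) <= 1 :> R.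
  apply: le_trans (conv_err_upper k.+1 cf).
  by rewrite mulrA -natrM ler_wpM2r// ler_nat.
move: low b1; set eta := _%:R * conv_err _ _ _ => low b1.
move=> bl /(_ b1) arc.
have quad : b%:R - eta * b%:R ^+ 2 <= ((a k.+1)%:R + 2) / 4.
  move: low; set c := (_ + 2) => low.
  have c0 : 0 < c by rewrite ltr_wpDl.
  have ceta : c^-1 <= eta by rewrite -[_^-1]mul1r ler_pdivrMr// mulrC.
  have : 0 <= (c / 2 - b%:R) ^+ 2 / c by rewrite divr_ge0 ?sqr_ge0// ltW.
  have -> : (c / 2 - b%:R) ^+ 2 / c = c / 4 - b%:R + b%:R ^+ 2 * c^-1.
    by field; rewrite gt_eqF.
  have := ler_wpM2l (sqr_ge0 (b%:R : R)) ceta.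
  by lra.
rewrite -[X in `|X|](subrK (sawtooth_sum
  ((conv_denom a k.+1)%:R * ((-1) ^+ k.+2 * conv_err a alpha k.+1))
  ((conv_denom a k.+1)%:R * z) b)).
apply: le_trans (ler_normD _ _) _; move: quad bl arc b1.
move: `|_| `|_| => x y; rewrite expr2; lra.
Qed.

Lemma sawtooth_sum_upper {R : realType} (a : nat -> nat) (alpha z : R) (k n : nat) :
  cfrac_expansion a alpha -> (n <= conv_denom a k.+1)%N ->
  `|sawtooth_sum alpha z n| <= (pq_sum a k)%:R / 8 + 3 * k%:R + 1 / 2.
Proof.
move=> cf; elim: k n z => [|k IH] n z nq.
  apply: le_trans (sawtooth_sum_le_half _ _ _) _.
  rewrite /pq_sum big_geq// mul0r mulr0 !add0r ler_wpM2r//.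
  by rewrite -[1]/(1%:R) ler_nat.
have q0 := conv_denom_gt0 a k cf.1.
rewrite {1}(divn_eq n (conv_denom a k.+1)) sawtooth_sumD.
apply: le_trans (ler_normD _ _) _.
have := sawtooth_sum_level a alpha z k (n %/ conv_denom a k.+1) cf
  (leq_trans (leq_trunc_div _ _) nq).
have := IH (n %% conv_denom a k.+1)%N
  (z + (n %/ conv_denom a k.+1 * conv_denom a k.+1)%:R * alpha)
  (ltnW (ltn_pmod _ q0)).
by rewrite pq_sumS natrD -(natr1 k); lra.
Qed.

(** * Lengths with large sawtooth sums *)

(** The [i]-th point lies within [i + 1] steps of [0], on the side given by the
    sign, so its fractional part is that close to the corresponding end of the
    unit interval.  The exception is a starting point equal to [0] approached
    from below, which costs [1]. *)
Lemma sawtooth_sum_near0 {R : realType} (eta x : R) (e : bool) (b : nat) :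
  0 < eta -> 0 <= (-1) ^+ e * x <= eta ->
  (-1) ^+ e * sawtooth_sum ((-1) ^+ e * eta) x b
    <= eta * b%:R * (b%:R + 1) / 2 - b%:R / 2 + (0 < b)%N%:R.
Proof.
move=> eta0 x0.
have term (i : nat) : (-1) ^+ e * (frac_part (x + i%:R * ((-1) ^+ e * eta)) - 1 / 2)
    <= (i%:R + 1) * eta - 1 / 2 + (i == 0%N)%:R.
  have i0 : 0 <= i%:R * eta by rewrite mulr_ge0// ltW.
  case: e x0 => /=; rewrite ?expr1 ?expr0 => x0.
    have [->|i1] := posnP i.
      by have := frac_part_ge0 (x + 0%:R * (-1 * eta)); rewrite /=; lra.
    have ieta : 0 < i%:R * eta by rewrite mulr_gt0// ltr0n.
    have y0 : x + i%:R * (-1 * eta) < 0 by lra.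
    by rewrite addr0; have := frac_part_neg_ge _ y0; lra.
  have y0 : 0 <= x + i%:R * (1 * eta) by lra.
  have := frac_part_le _ y0; have : 0 <= (i == 0%N)%:R :> R by [].
  by lra.
elim: b => [|b IH].
  by rewrite /sawtooth_sum big_geq// !mulr0 !mul0r subr0 add0r.
rewrite -addn1 sawtooth_sumD mulrDr addn1 /(sawtooth_sum _ _ 1) big_nat1.
rewrite mul0r addr0; have := term b; move: IH.
have -> : (0 < b.+1)%N%:R = (0 < b)%N%:R + (b == 0%N)%:R :> R.
  by case: (b) => [|?] /=; rewrite ?add0r ?addr0.
by rewrite -(natr1 b); lra.
Qed.

Lemma sawtooth_sum_level_half {R : realType} (a : nat -> nat) (alpha z : R) (k : nat) :
  cfrac_expansion a alpha ->
  0 <= (-1) ^+ k * z <= conv_err a alpha k.+1 ->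
  (-1) ^+ k * sawtooth_sum alpha z ((a k.+1)./2 * conv_denom a k.+1)
    <= - (a k.+1)%:R / 8 + 4.
Proof.
move=> cf z0; have a0 := cf.1; set b := (a k.+1)./2.
have q0 : 0 < (conv_denom a k.+1)%:R :> R by rewrite ltr0n conv_denom_gt0.
have := sawtooth_sum_blocks alpha _ z _ _ b (conv_denom_gt0 a k a0)
  (conv_coprime a k.+1) (conv_errE a alpha k.+1).
rewrite conv_theta_norm//.
have -> : (-1) ^+ k.+2 = (-1) ^+ odd k :> R by rewrite -signr_odd /= negbK.
have -> : (-1) ^+ k = (-1) ^+ odd k :> R by rewrite signr_odd.
rewrite mulrCA => bl.
have low := conv_err_lower k cf.
have up : (a k.+1)%:R * ((conv_denom a k.+1)%:R * conv_err a alpha k.+1) <= 1 :> R.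
  apply: le_trans (conv_err_upper k.+1 cf).
  rewrite mulrA -natrM ler_wpM2r ?conv_err_ge0// ler_nat conv_denomSS.
  exact: leq_addr.
have near0 : 0 <= (-1) ^+ odd k * ((conv_denom a k.+1)%:R * z)
    <= (conv_denom a k.+1)%:R * conv_err a alpha k.+1.
  rewrite mulrCA signr_odd mulr_ge0 ?ler0n//=; last by case/andP: z0.
  by rewrite ler_wpM2l//; case/andP: z0.
move: low up near0 bl; set eta := _%:R * conv_err _ _ _ => low up near0 bl.
have eta0 : 0 < eta.
  rewrite ltNge; apply/negP => eta0.
  have := mulr_ge0_le0 (addr_ge0 (ler0n R (a k.+1)) (ler0n R 2)) eta0.
  by move: low; lra.
have := sawtooth_sum_near0 _ _ _ b eta0 near0.
have : (0 < b)%N%:R <= 1 :> R by rewrite -[1]/(1%:R) ler_nat leq_b1.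
have a2 : b%:R * 2 <= (a k.+1)%:R :> R.
  by rewrite -natrM ler_nat /b; lia.
have a2' : (a k.+1)%:R <= b%:R * 2 + 1 :> R.
  by rewrite -natrM natr1 ler_nat /b; lia.
have b0 : 0 <= b%:R :> R by [].
have be : b%:R * eta <= 1 / 2.
  by have := ler_wpM2r (ltW eta0) a2; move: up; lra.
have bbe : (b%:R * eta) * (b%:R + 1) <= 1 / 2 * (b%:R + 1).
  by rewrite ler_wpM2r// addr_ge0.
move: bl; move: (sawtooth_sum _ _ b) => phi; rewrite ler_norml.
by case: (odd k); rewrite /= ?expr1 ?expr0; lra.
Qed.

(** A digit [b] contributes about [b * (1 - b / a) / 2] to the sawtooth sum,
    with a sign given by the parity of its place.  Half of the maximal digit at
    every place of one parity makes each contribution maximal and avoids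
    cancellation. *)
Fixpoint half_digit_number (a : nat -> nat) (e : bool) (k : nat) : nat :=
  if k is l.+1 then
    ((if odd k == e then (a k)./2 * conv_denom a k else 0)
      + half_digit_number a e l)%N
  else 0%N.

Definition parity_sum (a : nat -> nat) (e : bool) (k : nat) : nat :=
  (\sum_(1 <= m < k.+1 | odd m == e) a m)%N.

Lemma parity_sumS (a : nat -> nat) (e : bool) (k : nat) :
  parity_sum a e k.+1
    = (parity_sum a e k + if odd k.+1 == e then a k.+1 else 0)%N.
Proof. by rewrite /parity_sum big_mkcond big_nat_recr// -big_mkcond. Qed.

Lemma half_digit_succ_le (b : nat) : (0 < b)%N -> (b./2.+1 <= b)%N.
Proof. by lia. Qed.

Lemma half_digit_number_le (a : nat -> nat) (e : bool) (k : nat) :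
  (forall h, (1 <= h)%N -> (0 < a h)%N) ->
  (half_digit_number a e k <= conv_denom a k.+1)%N.
Proof.
move=> a0; elim: k => [//|k IH]; rewrite [half_digit_number _ _ _]/=.
apply: (@leq_trans (a k.+1 * conv_denom a k.+1)); last first.
  by rewrite conv_denomSS leq_addr.
apply: (@leq_trans ((a k.+1)./2.+1 * conv_denom a k.+1)).
  by rewrite mulSn addnC leq_add//; case: ifP.
by rewrite leq_mul2r half_digit_succ_le ?orbT ?a0.
Qed.

(** The largest digit is processed first.  It moves the starting point, modulo
    [1], by a multiple of the error of its place.  Errors at places of one
    parity have the same sign, and [1 + a / 2 <= a] errors of one place do not
    exceed the error of the preceding place, so the new starting point again
    satisfies the hypothesis for the remaining digits. *)
Lemma half_digit_sawtooth_sum {R : realType} (a : nat -> nat) (alpha z : R)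
    (e : bool) (k : nat) :
  cfrac_expansion a alpha ->
  0 <= (-1) ^+ (~~ e) * z <= conv_err a alpha k ->
  (-1) ^+ (~~ e) * sawtooth_sum alpha z (half_digit_number a e k)
    <= - (parity_sum a e k)%:R / 8 + 4 * k%:R.
Proof.
move=> cf; have a0 := cf.1; elim: k z => [|k IH] z z0.
  by rewrite /sawtooth_sum /parity_sum !big_geq// !mulr0 oppr0 mul0r addr0.
have leD := conv_err_leS k cf.
rewrite parity_sumS [half_digit_number _ _ _]/=; case: eqP => [ek|_]; last first.
  rewrite add0n addn0; apply: le_trans (IH z _) _.
    by case/andP: z0 => -> z1; apply: le_trans z1 leD.
  by rewrite -(natr1 k); lra.
have sE : (-1) ^+ (~~ e) = (-1) ^+ k :> R by rewrite -ek /= negbK signr_odd.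
move: IH z0; rewrite sE => IH z0.
rewrite sawtooth_sumD mulrDr.
have step := sawtooth_sum_level_half a alpha z k cf z0.
set b := (a k.+1)./2 in step *.
have -> : z + (b * conv_denom a k.+1)%:R * alpha
    = z + (-1) ^+ k * (b%:R * conv_err a alpha k.+1)
      + (b * conv_num a k.+1)%N%:Z%:~R.
  rewrite -pmulrn !natrM -mulrA conv_errE !exprS.
  by move: ((-1) ^+ k) => s; ring.
rewrite sawtooth_sumDz.
have := IH (z + (-1) ^+ k * (b%:R * conv_err a alpha k.+1)).
have d0 := conv_err_ge0 k.+1 cf.
rewrite mulrDr signrMK.
have bD : b%:R * conv_err a alpha k.+1 + conv_err a alpha k.+1
    <= (a k.+1)%:R * conv_err a alpha k.+1.
  rewrite -{2}[conv_err _ _ _]mul1r -mulrDl ler_wpM2r// natr1 ler_nat.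
  by rewrite half_digit_succ_le// a0.
have bD0 : 0 <= b%:R * conv_err a alpha k.+1 by rewrite mulr_ge0.
have := conv_err_mul_le k cf.
move=> aD IH'; have {}IH' := IH' ltac:(move: z0; lra).
by rewrite natrD -(natr1 k); move: step; lra.
Qed.

(** * Discrepancy and sawtooth sums *)

Lemma local_discrE {R : realType} (n : nat) (alpha beta : R) : 0 < beta < 1 ->
  local_discr n alpha beta
    = sawtooth_sum alpha (- beta) n - sawtooth_sum alpha 0 n.
Proof.
move=> b01; rewrite /local_discr /sawtooth_sum -sumrB.
have -> : beta * n%:R = \sum_(0 <= r < n) beta.
  by rewrite sumr_const_nat subn0 mulr_natr.
rewrite -sumrB; apply: eq_bigr => r _.
by rewrite indic_frac_part// add0r [- beta + _]addrC; ring.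
Qed.

Lemma local_discr_le {R : realType} (n : nat) (alpha beta : R) : 0 < beta < 1 ->
  `|local_discr n alpha beta| <= n%:R.
Proof.
move=> /local_discrE ->; apply: le_trans (ler_normB _ _) _.
have := sawtooth_sum_le_half alpha (- beta) n.
have := sawtooth_sum_le_half alpha 0 n.
by lra.
Qed.

(** The choice [beta = {n * alpha}] reverses the orbit: up to
    one term at each end, it turns the first of the two sawtooth sums into the
    opposite of the second. *)
Lemma local_discr_orbit {R : realType} (n : nat) (alpha : R) :
  irrational alpha -> (0 < n)%N ->
  local_discr n alpha (frac_part (n%:R * alpha))
    = - 2 * sawtooth_sum alpha 0 n - frac_part (n%:R * alpha).
Proof.
move=> irr n0; rewrite local_discrE; last first.
  by rewrite frac_part_irrational_gt0// frac_part_lt1.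
have one x : sawtooth_sum alpha x 1 = frac_part x - 1 / 2.
  by rewrite /sawtooth_sum big_nat1 mul0r addr0.
have -> : sawtooth_sum alpha (- frac_part (n%:R * alpha)) n
    = - sawtooth_sum alpha alpha n.
  have -> : - frac_part (n%:R * alpha)
      = - (n%:R * alpha) + (Num.floor (n%:R * alpha))%:~R.
    by rewrite /frac_part; ring.
  rewrite sawtooth_sumDz /sawtooth_sum big_nat_rev /= -sumrN.
  apply: eq_big_nat => j /andP[_ jn]; rewrite add0n natrB//.
  have -> : - (n%:R * alpha) + (n%:R - j.+1%:R) * alpha = - (j.+1%:R * alpha).
    by ring.
  have -> : alpha + j%:R * alpha = j.+1%:R * alpha by rewrite -(natr1 j); ring.
  by rewrite frac_partN ?frac_part_irrational_gt0//; field.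
have := sawtooth_sumD alpha 0 1 n.
rewrite addnC sawtooth_sumD !one !add0r [1%:R * alpha]mul1r.
have -> : frac_part (0 : R) = 0 by rewrite /frac_part floor0 subr0.
by lra.
Qed.

Lemma star_discrepancy_le {R : realType} (n : nat) (alpha B : R) : (0 < n)%N ->
  (forall beta, 0 < beta < 1 -> `|local_discr n alpha beta| <= B) ->
  n%:R * star_discrepancy n alpha <= B.
Proof.
move=> n0 dB; have nR : 0 < n%:R :> R by rewrite ltr0n.
rewrite mulrC -ler_pdivlMr//; apply: ge_sup.
  by exists `|n%:R^-1 * local_discr n alpha (1 / 2)|; exists (1 / 2) => //=; lra.
move=> _ [beta /= b01 <-].
by rewrite normrM ger0_norm ?invr_ge0// mulrC ler_pM2r ?invr_gt0// dB.
Qed.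

Lemma star_discrepancy_ge {R : realType} (n : nat) (alpha beta : R) : (0 < n)%N ->
  0 < beta < 1 -> `|local_discr n alpha beta| <= n%:R * star_discrepancy n alpha.
Proof.
move=> n0 b01; have nR : 0 < n%:R :> R by rewrite ltr0n.
rewrite [leRHS]mulrC -ler_pdivrMr//; apply: ub_le_sup.
  exists 1 => _ [gamma /= g01 <-].
  rewrite normrM ger0_norm ?invr_ge0// mulrC ler_pdivrMr// mul1r.
  exact: local_discr_le.
by exists beta => //; rewrite normrM ger0_norm ?invr_ge0// mulrC.
Qed.

Lemma star_discrepancy_ge0 {R : realType} (n : nat) (alpha : R) :
  0 <= n%:R * star_discrepancy n alpha.
Proof.
have [->|n0] := posnP n; first by rewrite mul0r.
by apply: le_trans (star_discrepancy_ge n alpha (1 / 2) n0 _) => //; lra.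
Qed.

Lemma star_discrepancy_upper {R : realType} (a : nat -> nat) (alpha : R)
    (k n : nat) :
  cfrac_expansion a alpha -> (0 < n)%N -> (n <= conv_denom a k.+1)%N ->
  n%:R * star_discrepancy n alpha <= (pq_sum a k)%:R / 4 + 6 * k%:R + 1.
Proof.
move=> cf n0 nq; apply: star_discrepancy_le => // beta /local_discrE ->.
apply: le_trans (ler_normB _ _) _.
have := sawtooth_sum_upper a alpha (- beta) k n cf nq.
have := sawtooth_sum_upper a alpha 0 k n cf nq.
by lra.
Qed.

Lemma half_digit_sawtooth_sum_norm {R : realType} (a : nat -> nat) (alpha : R)
    (e : bool) (k : nat) :
  cfrac_expansion a alpha ->
  (parity_sum a e k)%:R / 8 - 4 * k%:R
    <= `|sawtooth_sum alpha 0 (half_digit_number a e k)|.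
Proof.
move=> cf; have := half_digit_sawtooth_sum a alpha 0 e k cf.
rewrite mulr0 lexx conv_err_ge0// => /(_ isT) low.
have := ler_norm (- ((-1) ^+ (~~ e) * sawtooth_sum alpha 0 (half_digit_number a e k))).
by rewrite normrN normrM normrX normrN1 expr1n mul1r; move: low; lra.
Qed.

Lemma star_discrepancy_lower {R : realType} (a : nat -> nat) (alpha : R)
    (e : bool) (k : nat) :
  cfrac_expansion a alpha -> irrational alpha ->
  (0 < half_digit_number a e k)%N ->
  (parity_sum a e k)%:R / 4 - 8 * k%:R - 1
    <= (half_digit_number a e k)%:R
       * star_discrepancy (half_digit_number a e k) alpha.
Proof.
move=> cf irr n0; have := half_digit_sawtooth_sum_norm a alpha e k cf.
move: n0; set n := half_digit_number a e k => n0 low.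
have b01 : 0 < frac_part (n%:R * alpha) < 1.
  by rewrite frac_part_irrational_gt0// frac_part_lt1.
apply: le_trans (star_discrepancy_ge n alpha _ n0 b01).
rewrite local_discr_orbit// -normrN.
have := lerB_normD (2 * sawtooth_sum alpha 0 n) (frac_part (n%:R * alpha)).
rewrite normrM ger0_norm// [X in _ - X]ger0_norm ?frac_part_ge0//.
have -> : - (- 2 * sawtooth_sum alpha 0 n - frac_part (n%:R * alpha))
   = 2 * sawtooth_sum alpha 0 n + frac_part (n%:R * alpha) by ring.
by move: low b01; lra.
Qed.

(** * The order of an integer *)

Lemma cf_denom_le (a : nat -> nat) (m n : nat) :
  (forall h, (1 <= h)%N -> (0 < a h)%N) -> (m <= n)%N ->
  (cf_denom a m <= cf_denom a n)%N.
Proof. by move=> a0 mn; exact: (conv_denom_le a m.+1 n.+1 a0 mn). Qed.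

(** The carry rule makes the digits below place [k] sum up to less than
    [q_(k+1)], as in a positional system; it is needed exactly when the digit at
    place [k] is maximal, where it reduces the claim to place [k - 2]. *)
Lemma ostrowski_bounds (a : nat -> nat) (r N : nat) (c : nat -> nat) :
  (forall h, (1 <= h)%N -> (0 < a h)%N) -> ostrowski a r N c ->
  (cf_denom a N <= r < cf_denom a N.+1)%N.
Proof.
move=> a0 [-> c0 ca carry cN]; apply/andP; split.
  by rewrite big_nat_recr//= (leq_trans _ (leq_addl _ _))// leq_pmull.
suff partial k : (k <= N)%N ->
    (\sum_(0 <= h < k.+1) c h * cf_denom a h < cf_denom a k.+1)%N by exact: partial.
elim/ltn_ind: k => -[|k] IH kN.
  by rewrite big_nat1 muln1 /=; have := a0 1%N isT; lia.
have rec : cf_denom a k.+2 = (a k.+2 * cf_denom a k.+1 + cf_denom a k)%N by [].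
have -> : (\sum_(0 <= h < k.+2) c h * cf_denom a h = \sum_(0 <= h < k.+1)
    c h * cf_denom a h + c k.+1 * cf_denom a k.+1)%N by rewrite big_nat_recr.
rewrite rec; have := IH k (ltnSn k) (ltnW kN).
have := ca k.+1 kN; rewrite leq_eqVlt => /predU1P[ck|ck] prev.
  have := carry k.+1 kN ck; rewrite /= ck => ck0.
  case: k => [|k] in IH kN rec prev ck ck0 *.
    by rewrite big_nat1 ck0 mul0n /=; lia.
  rewrite big_nat_recr//= ck0 mul0n addn0 addnC ltn_add2l.
  apply: leq_trans (cf_denom_le a k.+1 k.+1 a0 _) => //.
  exact: IH (ltnW (ltnW kN)).
have : (c k.+1 * cf_denom a k.+1 + cf_denom a k.+1
    <= a k.+2 * cf_denom a k.+1)%N by rewrite -mulSnr leq_mul2r ck orbT.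
by move: prev; lia.
Qed.

Lemma cf_denom_gt0 (a : nat -> nat) (n : nat) :
  (forall h, (1 <= h)%N -> (0 < a h)%N) -> (0 < cf_denom a n)%N.
Proof. exact: conv_denom_gt0. Qed.

Lemma cf_denom_ge (a : nat -> nat) (n : nat) :
  (forall h, (1 <= h)%N -> (0 < a h)%N) -> (n <= cf_denom a n)%N.
Proof.
move=> a0; elim/ltn_ind: n => -[//|[_|n IH]]; first exact: a0.
have -> : cf_denom a n.+2 = (a n.+2 * cf_denom a n.+1 + cf_denom a n)%N by [].
have := IH n.+1 (ltnSn _); have := cf_denom_gt0 a n a0.
have := leq_pmull (cf_denom a n.+1) (a0 n.+2 isT); lia.
Qed.

(** Greedily, as many copies as possible of the largest [q_N <= r] are removed;
    the remainder is below [q_N], so its expansion uses smaller places only. *)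
Lemma ostrowski_exists (a : nat -> nat) (r : nat) :
  (forall h, (1 <= h)%N -> (0 < a h)%N) -> (0 < r)%N ->
  exists N c, ostrowski a r N c.
Proof.
move=> a0; elim/ltn_ind: r => r IH r0.
have exN : exists N, (cf_denom a N <= r)%N by exists 0%N.
have bdN N : (cf_denom a N <= r)%N -> (N <= r)%N.
  exact: leq_trans (cf_denom_ge a N a0).
case: (ex_maxnP exN bdN) => N qN maxN.
have rN : (r < cf_denom a N.+1)%N.
  by rewrite ltnNge; apply/negP => /maxN; rewrite ltnn.
have q0 := cf_denom_gt0 a N a0.
pose b := (r %/ cf_denom a N)%N; pose s := (r %% cf_denom a N)%N.
have rE : r = (b * cf_denom a N + s)%N := divn_eq _ _.
have sq : (s < cf_denom a N)%N by rewrite ltn_mod.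
have b0 : (0 < b)%N by rewrite divn_gt0.
have ba : (1 <= N)%N -> (b <= a N.+1)%N.
  case: N qN {maxN} rN q0 b s rE sq b0 => // n qN rN q0 b s rE sq b0 _.
  rewrite -ltnS -(ltn_pmul2r q0); apply: (@leq_ltn_trans r).
    by rewrite rE leq_addr.
  apply: leq_trans rN _; rewrite mulSnr leq_add2l; exact: cf_denom_le.
have ba0 : N = 0%N -> (b <= a 1%N - 1)%N.
  move=> N0; move: rN rE; rewrite N0 /= => rN rE.
  by have := a0 1%N isT; move: rE; rewrite muln1; lia.
have [s0|s0] := posnP s.
  exists N, (fun h => if h == N then b else 0%N); split.
  - rewrite big_nat_recr//= eqxx big_nat_cond big1 ?add0n ?rE ?s0 ?addn0//.
    by move=> h /andP[/andP[_ hN] _]; rewrite ltn_eqF.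
  - by case: eqP => // /esym.
  - by move=> h /andP[h1 hN]; case: eqP => // hE; rewrite hE; apply: ba; rewrite -hE.
  - move=> h /andP[h1 hN]; case: eqP => [-> _|_ /esym ah].
      by rewrite ltn_eqF//; case: (N) (leq_trans h1 hN).
    by have := a0 h.+1 isT; rewrite ah.
  - by rewrite eqxx.
have [M [c oc]] := IH s (leq_trans sq qN) s0.
have /andP[qM sM] := ostrowski_bounds a s M c a0 oc.
have MN : (M < N)%N.
  rewrite ltnNge; apply/negP => /(cf_denom_le a _ _ a0) /leq_trans/(_ qM).
  by rewrite leqNgt sq.
case: oc => sE c0 ca carry cM.
exists N, (fun h => if h == N then b else if (h <= M)%N then c h else 0%N); split.
- rewrite big_nat_recr//= eqxx rE addnC; congr addn.
  rewrite sE (@big_cat_nat _ _ _ M.+1 0 N)//= [X in (_ + X)%N]big_nat_cond.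
  rewrite [X in (_ + X)%N]big1 ?addn0; last first.
    move=> h /andP[/andP[Mh hN] _]; rewrite ltn_eqF// leqNgt Mh; exact: mul0n.
  apply: eq_big_nat => h /andP[_ hM]; rewrite ltn_eqF ?(leq_trans hM)//.
  by rewrite -ltnS hM.
- by case: eqP => [/esym/ba0//|_]; rewrite leq0n.
- move=> h /andP[h1 hN]; case: eqP => [->|_]; first by apply: ba; apply: leq_trans hN.
  by case: ifP => // hM; apply: ca; rewrite h1.
- move=> h /andP[h1 hN]; case: eqP => [->|hN'].
    move=> bE; have N1 : (0 < N)%N by exact: leq_trans hN.
    rewrite ltn_eqF ?prednK//; case: ifP => // MN1.
    (* With a maximal top digit the remainder is below [q_(N-1)], since
       [r < q_(N+1)]; hence its expansion cannot reach the place [N - 1]. *)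
    suff sN : (s < cf_denom a N.-1)%N.
      have := leq_ltn_trans qM sN; rewrite ltnNge => /negP[].
      apply: cf_denom_le => //; lia.
    have qE : (cf_denom a N.+1 = a N.+1 * cf_denom a N + cf_denom a N.-1)%N.
      by case: (N) N1.
    by move: rN; rewrite qE {1}rE bE ltn_add2l.
  case: ifP => [hM|hM /esym ah]; last by have := a0 h.+1 isT; rewrite ah.
  move=> cE; have := carry h; rewrite h1 hM => /(_ isT cE) ch.
  rewrite ltn_eqF; first by rewrite ch if_same.
  by case: (h) h1 hN hN' => // h' _ hN _; exact: ltnW.
- by rewrite eqxx.
Qed.

Lemma ostrowski_ord_bounds (a : nat -> nat) (r : nat) :
  (forall h, (1 <= h)%N -> (0 < a h)%N) -> (0 < r)%N ->
  (cf_denom a (ostrowski_ord a r) <= r < cf_denom a (ostrowski_ord a r).+1)%N.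
Proof.
move=> a0 r0; have [N [c oc]] := ostrowski_exists a r a0 r0.
have : exists N, [set N | exists c, ostrowski a r N c] N by exists N, c.
by move=> /(xgetPex 0%N) [c' /(ostrowski_bounds _ _ _ _ a0)].
Qed.

(** * Limits superior and inferior *)

Lemma limn_esupE {R : realType} (u : (\bar R)^nat) :
  limn_esup u = ereal_inf (range (esups u)).
Proof. by rewrite limn_esup_lim; apply/cvg_lim => //; exact: cvg_esups_inf. Qed.

Lemma limn_esup_le_eventually {R : realType} (u : (\bar R)^nat) (c : \bar R) (N : nat) :
  (forall n, (N <= n)%N -> (u n <= c)%E) -> (limn_esup u <= c)%E.
Proof.
move=> uc; rewrite limn_esupE.
apply: (@le_trans _ _ (esups u N)); first by apply: ereal_inf_lbound; exists N.
by apply: ge_ereal_sup => _ [n /= Nn <-]; exact: uc.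
Qed.

Lemma limn_esup_ge_often {R : realType} (u : (\bar R)^nat) (c : \bar R) :
  (forall N, exists2 n, (N <= n)%N & (c <= u n)%E) -> (c <= limn_esup u)%E.
Proof.
move=> cu; rewrite limn_esupE; apply: le_ereal_inf_tmp => _ [N _ <-].
have [n Nn cn] := cu N; apply: le_trans cn _.
by apply: ereal_sup_ubound; exists n.
Qed.

Lemma limn_esup_lt_eventually {R : realType} (u : (\bar R)^nat) (c : \bar R) :
  (limn_esup u < c)%E -> exists N, forall n, (N <= n)%N -> (u n < c)%E.
Proof.
rewrite limn_esupE => /ereal_inf_lt[_ [N _ <-] Nc]; exists N => n Nn.
by apply: le_lt_trans Nc; apply: ereal_sup_ubound; exists n.
Qed.

Lemma limn_einf_gt_eventually {R : realType} (u : (\bar R)^nat) (c : \bar R) :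
  (c < limn_einf u)%E -> exists N, forall n, (N <= n)%N -> (c < u n)%E.
Proof.
rewrite -[limn_einf u]oppeK -limn_esupN lteNr => /limn_esup_lt_eventually[N uN].
by exists N => n Nn; rewrite -lteN2; exact: uN.
Qed.

(** * Asymptotics of the normalised discrepancy *)

Lemma pq_sum_ge (a : nat -> nat) (k : nat) :
  (forall h, (1 <= h)%N -> (0 < a h)%N) -> (k <= pq_sum a k)%N.
Proof.
move=> a0; elim: k => // k IH; by rewrite pq_sumS; have := a0 k.+1 isT; lia.
Qed.

Lemma pq_sum_le (a : nat -> nat) (k l : nat) :
  (k <= l)%N -> (pq_sum a k <= pq_sum a l)%N.
Proof.
move=> /subnKC <-; elim: (l - k)%N => [|d IH]; first by rewrite addn0.
by rewrite addnS pq_sumS (leq_trans IH)// leq_addr.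
Qed.

Lemma index_small {R : realType} (a : nat -> nat) (eps : R) :
  (forall h, (1 <= h)%N -> (0 < a h)%N) ->
  limn_esup (fun k : nat => (k%:R / (pq_sum a k)%:R : R)%:E) = 0%E -> 0 < eps ->
  exists K, forall k, (K <= k)%N -> k%:R <= eps * (pq_sum a k)%:R.
Proof.
move=> a0 lim0 eps0.
have [K hK] : exists K, forall k, (K <= k)%N ->
    ((k%:R / (pq_sum a k)%:R : R)%:E < eps%:E)%E.
  by apply: limn_esup_lt_eventually; rewrite lim0 lte_fin.
exists K.+1 => k Kk; have /= := hK k (ltnW Kk); rewrite lte_fin ltr_pdivrMr.
  exact: ltW.
by rewrite ltr0n (leq_trans _ (pq_sum_ge a k a0))// (leq_trans _ Kk).
Qed.

Definition normalized_discrepancy {R : realType} (a : nat -> nat) (alpha : R)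
    (n : nat) : R :=
  n%:R * star_discrepancy n alpha / (pq_sum a (ostrowski_ord a (n - 1)).+1)%:R.

Lemma normalized_discrepancy_ge0 {R : realType} (a : nat -> nat) (alpha : R)
    (n : nat) : 0 <= normalized_discrepancy a alpha n.
Proof. by rewrite divr_ge0 ?star_discrepancy_ge0. Qed.

Lemma limsup_upper {R : realType} (a : nat -> nat) (alpha : R) :
  cfrac_expansion a alpha ->
  limn_esup (fun k : nat => (k%:R / (pq_sum a k)%:R : R)%:E) = 0%E ->
  (limn_esup (fun n => (normalized_discrepancy a alpha n)%:E) <= (4^-1)%:E)%E.
Proof.
move=> cf lim0; have a0 := cf.1; apply/lee_addgt0Pr => eps eps0.
have [|K hK] := index_small a (eps / 7) a0 lim0; first by lra.
apply: (@limn_esup_le_eventually _ _ _ (cf_denom a K).+2) => n Kn.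
have n1 : (0 < n - 1)%N by lia.
have /andP[_] := ostrowski_ord_bounds a (n - 1) a0 n1.
rewrite /normalized_discrepancy; set N := ostrowski_ord a (n - 1) => nN.
have n0 : (0 < n)%N by lia.
have nq : (n <= conv_denom a N.+2)%N.
  by rewrite -[conv_denom a _]/(cf_denom a N.+1); move: n0 nN; lia.
have KN : (K <= N.+1)%N.
  rewrite leqNgt; apply/negP => NK.
  by have := cf_denom_le a N.+1 K a0 (ltnW NK); lia.
have s0 : 0 < (pq_sum a N.+1)%:R :> R.
  by rewrite ltr0n (leq_trans _ (pq_sum_ge a N.+1 a0)).
rewrite -EFinD lee_fin ler_pdivrMr//.
have := star_discrepancy_upper a alpha N.+1 n cf n0 nq.
have := hK N.+1 KN; have : 1 <= N.+1%:R :> R by rewrite ler1n.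
by lra.
Qed.

(** The order of [n - 1] is less than [k] when [n] is the half-digit number
    of length [k], so that replacing the normalisation by [pq_sum a k] can only
    lower the ratio. *)
Lemma limsup_lower_real {R : realType} (a : nat -> nat) (alpha c : R) (e : bool) :
  cfrac_expansion a alpha -> irrational alpha ->
  limn_esup (fun k : nat => (k%:R / (pq_sum a k)%:R : R)%:E) = 0%E ->
  (c%:E < limn_einf (fun k => ((parity_sum a e k)%:R / (pq_sum a k)%:R)%:E))%E ->
  ((c / 4)%:E <= limn_esup (fun n => (normalized_discrepancy a alpha n)%:E))%E.
Proof.
move=> cf irr lim0 cl; have a0 := cf.1; apply/lee_subgt0Pr => eps eps0.
rewrite -EFinB; have [neg|pos] := ltP (c / 4 - eps) 0.
  apply: limn_esup_ge_often => N; exists N => //.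
  by rewrite lee_fin (le_trans (ltW neg))// normalized_discrepancy_ge0.
have [K1 hK1] := limn_einf_gt_eventually _ _ cl.
have [|K2 hK2] := index_small a (eps / 9) a0 lim0; first by lra.
apply: limn_esup_ge_often => M; pose k := (K1 + K2 + M + 2)%N.
have k0 : (0 < k)%N by lia.
have k1 : 1 <= k%:R :> R by rewrite ler1n.
have s0 : 0 < (pq_sum a k)%:R :> R.
  by rewrite ltr0n (leq_trans _ (pq_sum_ge a k a0)).
have low : c * (pq_sum a k)%:R <= (parity_sum a e k)%:R.
  have /hK1 : (K1 <= k)%N by lia.
  by rewrite lte_fin ltr_pdivlMr// => /ltW.
have small : k%:R <= eps / 9 * (pq_sum a k)%:R by apply: hK2; lia.
set n := half_digit_number a e k.
have nk : (k <= n)%N.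
  rewrite -(ler_nat R).
  have := half_digit_sawtooth_sum_norm a alpha e k cf.
  have := sawtooth_sum_le_half alpha 0 n.
  have := mulr_ge0 pos (ltW s0); rewrite -/n; lra.
exists n; first by lia.
have n1 : (0 < n - 1)%N by lia.
have /andP[ordn _] := ostrowski_ord_bounds a (n - 1) a0 n1.
have nq : (n <= cf_denom a k)%N := half_digit_number_le a e k a0.
rewrite lee_fin /normalized_discrepancy.
set N := ostrowski_ord a (n - 1) in ordn *.
have Nk : (N.+1 <= k)%N.
  by rewrite ltnNge; apply/negP => /(cf_denom_le a k N a0); lia.
have sN0 : 0 < (pq_sum a N.+1)%:R :> R.
  by rewrite ltr0n (leq_trans _ (pq_sum_ge a N.+1 a0)).
rewrite ler_pdivlMr//.
apply: (@le_trans _ _ ((c / 4 - eps) * (pq_sum a k)%:R)).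
  by rewrite ler_wpM2l// ler_nat pq_sum_le.
have := star_discrepancy_lower a alpha e k cf irr; rewrite -/n.
by have /[swap]/[apply] : (0 < n)%N by [lia]; lra.
Qed.

Lemma parity_ratio_ge0 {R : realType} (a : nat -> nat) (e : bool) :
  (0 <= limn_einf (fun k : nat =>
    ((parity_sum a e k)%:R / (pq_sum a k)%:R : R)%:E))%E.
Proof.
rewrite -leeN2 oppe0 -limn_esupN; apply: (@limn_esup_le_eventually _ _ _ 0%N) => n _ /=.
by rewrite lee_fin oppr_le0 divr_ge0.
Qed.

Lemma limsup_lower {R : realType} (a : nat -> nat) (alpha : R) (e : bool) :
  cfrac_expansion a alpha -> irrational alpha ->
  limn_esup (fun k : nat => (k%:R / (pq_sum a k)%:R : R)%:E) = 0%E ->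
  ((4^-1)%:E * limn_einf (fun k => ((parity_sum a e k)%:R / (pq_sum a k)%:R)%:E)
    <= limn_esup (fun n => (normalized_discrepancy a alpha n)%:E))%E.
Proof.
move=> cf irr lim0; have lower := limsup_lower_real a alpha _ e cf irr lim0.
move: (parity_ratio_ge0 (R := R) a e) lower.
case: (limn_einf _) => [l| |] //= l0 lower.
- apply/lee_subgt0Pr => eps eps0.
  have /lower : ((l - 4 * eps)%:E < l%:E)%E by rewrite lte_fin; lra.
  by apply: le_trans; rewrite -EFinM -EFinB lee_fin; lra.
- suff -> : limn_esup (fun n => (normalized_discrepancy a alpha n)%:E) = +oo%E.
    by rewrite leey.
  apply/eqyP => A _; have := lower (A * 4) (ltry _).
  by rewrite mulfK.
Qed.

Theorem theorem4p8 (R : realType) (a : nat -> nat) (alpha : R)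
  (alpha01 : 0 < alpha < 1)
  (alpha_irr : irrational alpha)
  (alpha_cf : cfrac_expansion a alpha)
  (a_unbounded : forall M : nat, exists k : nat, (1 <= k)%N /\ (M < a k)%N)
  (ell_pos : (0 < ell_even R a ^+ 2 + ell_odd R a ^+ 2)%E)
  (limsup0 : limn_esup (fun k : nat => (k%:R / (pq_sum a k)%:R : R)%:E) = 0%E) :
  let L : \bar R := limn_esup (fun n : nat =>
    (n%:R * star_discrepancy n alpha
       / (pq_sum a (ostrowski_ord a (n - 1)).+1)%:R)%:E) in
  ((4^-1)%:E * maxe (ell_even R a) (ell_odd R a) <= L)%E /\ (L <= (4^-1)%:E)%E.
Proof.
move=> L; split; last exact: limsup_upper.
have evenE : ell_even R a = limn_einf (fun k =>
    ((parity_sum a false k)%:R / (pq_sum a k)%:R)%:E).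
  congr limn_einf; apply/funext => k; congr (_%:R / _)%:E.
  by apply: eq_bigl => m; rewrite eqbF_neg.
have oddE : ell_odd R a = limn_einf (fun k =>
    ((parity_sum a true k)%:R / (pq_sum a k)%:R)%:E).
  congr limn_einf; apply/funext => k; congr (_%:R / _)%:E.
  by apply: eq_bigl => m; rewrite eqb_id.
by rewrite evenE oddE maxEle; case: ifP => _; exact: limsup_lower.
Qed.
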